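(* Let $\mathbf{X} = (X_n)_{n=1}^\infty$ be a compact matrix convex set in a finite-dimensional locally convex complex vector space $V$. Then $\mathbf{X}$ is the matrix convex hull of its matrix extreme points.
   Context: $M_n(V) = M_n \otimes V$ is the space of $n\times n$ matrices over $V$, with the product topology; scalar matrices of suitable sizes multiply elements of $M_n(V)$ from the left and right. $M_{k,n}$ denotes the complex $k \times n$ matrices. Let $\mathbf{X} = (X_n)_{n=1}^\infty$ with $X_n \subset M_n(V)$. A matrix convex combination of elements $x_i \in M_{n_i}(V)$, $1 \le i \le s$, is an expression $x = \sum_{i=1}^s \gamma_i^* x_i \gamma_i \in M_n(V)$ with $\gamma_i \in M_{n_i,n}$ and $\sum_{i=1}^s \gamma_i^*\gamma_i = I_n$. It is called proper if each $\gamma_i$ is surjective, and trivial if $n_i = n$ for all $i$ and each $x_i$ is unitarily equivalent to $x$ (i.e. $x_i = u_i^* x u_i$ for some unitary $u_i \in M_n$). $\mathbf{X}$ is matrix convex if it is closed under matrix convex combinations of its elements; it is compact if each $X_n$ is compact. An element $x \in X_n$ is a matrix extreme point of $\mathbf{X}$ if whenever $x$ is expressed as a proper matrix convex combination of elements of $\mathbf{X}$, this matrix convex combination is trivial. The matrix convex hull of a collection is the smallest matrix convex set containing it, equivalently the set of all matrix convex combinations of its elements. *)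

(* Defs.v *)
From HB Require Import structures.
From mathcomp Require Import all_boot all_order all_algebra.
From mathcomp Require Import complex.
From mathcomp Require Import boolp classical_sets reals.
From mathcomp Require Import topology normedtype.

Set Implicit Arguments.
Unset Strict Implicit.
Unset Printing Implicit Defensive.

Import GRing.Theory Num.Theory.

Local Open Scope ring_scope.
Local Open Scope classical_set_scope.
Local Open Scope sesquilinear_scope.

(* Locally convex topological vector spaces of finite dimension: [Tvs] already
   includes local convexity, but not the Hausdorff axiom. *)
#[short(type="vectTvsType")]
HB.structure Definition VectTvs (K : numDomainType) :=
  {V of Tvs K V & Vector K V}.

Reserved Notation "a *ml x" (at level 40, left associativity).
Reserved Notation "x *mr b" (at level 40, left associativity).

Section MatrixConvexity.
Variables (C : numClosedFieldType) (V : lmodType C).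

Definition lmul_mx m n p (a : 'M[C]_(m, n)) (x : 'M[V]_(n, p)) : 'M[V]_(m, p) :=
  \matrix_(i, j) \sum_k a i k *: x k j.

Definition rmul_mx m n p (x : 'M[V]_(m, n)) (b : 'M[C]_(n, p)) : 'M[V]_(m, p) :=
  \matrix_(i, j) \sum_k b k j *: x i k.

Local Notation "a *ml x" := (lmul_mx a x).
Local Notation "x *mr b" := (rmul_mx x b).

(* A family (X_n), n >= 1, of subsets of the M_n(V). All matrix sizes are
   positive, so [X n], and more generally any size index [n : nat] below, refers
   to matrices of size n.+1. *)
Definition mx_family := forall n : nat, set 'M[V]_(n.+1).

Definition mx_conv_comb (s n : nat) (m : 'I_s -> nat)
    (g : forall i, 'M[C]_((m i).+1, n.+1)) (x : forall i, 'M[V]_((m i).+1))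
    (y : 'M[V]_(n.+1)) : Prop :=
  \sum_i (g i)^t* *m g i = 1%:M /\ y = \sum_i (g i)^t* *ml x i *mr g i.

Definition proper_comb (s n : nat) (m : 'I_s -> nat)
    (g : forall i, 'M[C]_((m i).+1, n.+1)) : Prop :=
  forall i (w : 'cV[C]_((m i).+1)), exists v : 'cV[C]_(n.+1), g i *m v = w.

Definition trivial_comb (s n : nat) (m : 'I_s -> nat)
    (x : forall i, 'M[V]_((m i).+1)) (y : 'M[V]_(n.+1)) : Prop :=
  forall i, exists (e : m i = n) (u : 'M[C]_(n.+1)), u \is unitarymx /\
    castmx (congr1 S e, congr1 S e) (x i) = u^t* *ml y *mr u.

Definition matrix_convex (X : mx_family) : Prop :=
  forall (s n : nat) (m : 'I_s -> nat)
    (g : forall i, 'M[C]_((m i).+1, n.+1)) (x : forall i, 'M[V]_((m i).+1))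
    (y : 'M[V]_(n.+1)),
  (forall i, X (m i) (x i)) -> mx_conv_comb g x y -> X n y.

Definition matrix_extreme (X : mx_family) : mx_family := fun n =>
  [set y | X n y /\
    forall (s : nat) (m : 'I_s -> nat)
      (g : forall i, 'M[C]_((m i).+1, n.+1)) (x : forall i, 'M[V]_((m i).+1)),
    (forall i, X (m i) (x i)) -> mx_conv_comb g x y -> proper_comb g ->
    trivial_comb x y].

Definition matrix_convex_hull (E : mx_family) : mx_family := fun n =>
  [set y | forall X : mx_family,
    matrix_convex X -> (forall k, E k `<=` X k) -> X n y].

End MatrixConvexity.

Arguments matrix_extreme {C V} X n _.
Arguments matrix_convex_hull {C V} E n _.

(* Main.v *)
(* Fix n and consider the real convex cone Q of all pairs (g^* g, g^* x g) in
   M_n x M_n(V) with x in X_r, g in M_(r,n) nonzero and r arbitrary; it is closed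
   under sums because X is closed under direct sums. If g is onto and the pair
   lies on an extreme ray of Q, then x is matrix extreme: a proper matrix convex
   combination for x is conjugated by g into a decomposition of the pair, so each
   of its coefficients is a multiple of a unitary. Minkowski's argument shows
   that Q is generated by its extreme rays: from p in Q move in both directions
   along a trace-zero line of the minimal face of p until leaving Q, which is
   possible because X_n is compact and V is Hausdorff, and induct on the
   dimension of that face. A decomposition of (1, x) into extreme rays is then a
   matrix convex combination of matrix extreme points equal to x. *)
Require Import Defs.
From HB Require Import structures.
From mathcomp Require Import all_boot all_order all_algebra.
From mathcomp Require Import complex.
From mathcomp Require Import boolp classical_sets reals.
From mathcomp Require Import topology normedtype derive.
From mathcomp Require Import lra.
Set Implicit Arguments.
Unset Strict Implicit.
Unset Printing Implicit Defensive.
Import Order.TTheory GRing.Theory Num.Theory.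
Local Open Scope ring_scope.
Local Open Scope classical_set_scope.
Local Open Scope sesquilinear_scope.
Import numFieldNormedType.Exports.

(** * Cones generated by their extreme rays *)

Section ConeDecomposition.
Variables (R : realFieldType) (F : vectType R).
Implicit Types (Q H : F -> Prop) (p q v : F) (tau : {linear F -> R^o}).

(** Only positive multiples are required, so 0 may lie outside; the cones used below avoid it, since
    a linear functional is positive on them. *)
Definition is_cone Q :=
  (forall p q, Q p -> Q q -> Q (p + q)) /\
  (forall (t : R) p, 0 < t -> Q p -> Q (t *: p)).

Definition extreme_ray Q e :=
  Q e /\ forall p q, Q p -> Q q -> e = p + q -> exists t : R, p = t *: e.

(* The directions in which [Q] extends on both sides of [p], i.e. the span of
   the smallest face of the cone containing [p]. *)
Definition face_dir Q p v := exists c : R, Q (c *: p + v) /\ Q (c *: p - v).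

Lemma face_dirxx Q p : is_cone Q -> Q p -> face_dir Q p p.
Proof.
(* The coefficient 1 would require 0 to be in [Q]. *)
move=> [QD _] Qp; exists 2; rewrite scaler_nat mulr2n addrK.
by split=> //; exact: QD (QD _ _ Qp Qp) Qp.
Qed.

Lemma face_dirD Q p u v :
  is_cone Q -> face_dir Q p u -> face_dir Q p v -> face_dir Q p (u + v).
Proof.
move=> [QD _] [c [c1 c2]] [d [d1 d2]]; exists (c + d).
by rewrite scalerDl opprD !(addrACA (c *: p) (d *: p)); split; apply: QD.
Qed.

Lemma face_dirZ Q p (t : R) v :
  is_cone Q -> Q p -> face_dir Q p v -> face_dir Q p (t *: v).
Proof.
move=> [QD QZ] Qp [c [c1 c2]].
have [t0|t0|<-] := ltgtP 0 t.
- exists (t * c); rewrite -scalerA -scalerDr -scalerBr.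
  by split; [exact: QZ c1|exact: QZ c2].
- have t0' : 0 < - t by rewrite oppr_gt0.
  exists (- t * c); split.
    by have := QZ _ _ t0' c2; rewrite scalerBr scalerA !scaleNr opprK.
  by have := QZ _ _ t0' c1; rewrite scalerDr scalerA !scaleNr.
- by exists 1; rewrite scale0r scale1r subr0 addr0.
Qed.

(** The identity [e c p + w = e (c p - p') + (e p' + w)], for [w = v] and [w = -v], transfers
    directions as soon as [e > 0]. *)
Lemma face_dir_sub Q p p' (c : R) v : is_cone Q -> Q p' ->
  Q (c *: p - p') -> face_dir Q p' v -> face_dir Q p v.
Proof.
move=> [QD QZ] Qp' Qpp' [d [d1 d2]].
have [e [e0 e1 e2]] : exists e : R, [/\ 0 < e, Q (e *: p' + v) & Q (e *: p' - v)].
  (* A nonpositive coefficient is raised to 1 by adding a positive multiple of [p']. *)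
  have [d0|d0] := ltP 0 d; first by exists d.
  exists 1; have k0 : 0 < 1 - d by rewrite subr_gt0 (le_lt_trans d0).
  have kE w : 1 *: p' + w = (1 - d) *: p' + (d *: p' + w).
    by rewrite addrA -scalerDl subrK.
  by split=> //; rewrite kE; apply: QD => //; apply: QZ.
exists (e * c).
have E w : (e * c) *: p + w = e *: (c *: p - p') + (e *: p' + w).
  by rewrite addrA -scalerDr subrK scalerA.
by rewrite !E; split; apply: QD => //; apply: QZ.
Qed.

(** [face_dir Q p] is only a predicate, so its dimension is bounded through the subspaces it
    contains. *)
Definition face_dim_le Q p k := forall U : {vspace F},
  (forall u, u \in U -> face_dir Q p u) -> (\dim U <= k)%N.

(* The new face lies in the old one, but it no longer contains the direction
   [v]: otherwise one could move further than [t]. *)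
Lemma face_dim_exit Q tau p v (t : R) k : is_cone Q ->
  (forall q, Q q -> 0 < tau q) -> Q p -> tau v = 0 -> face_dir Q p v ->
  0 < t -> Q (p + t *: v) -> (forall t', t < t' -> ~ Q (p + t' *: v)) ->
  face_dim_le Q p k.+1 -> face_dim_le Q (p + t *: v) k.
Proof.
move=> Qcone tauQ Qp tauv pv t0 Qp' maxt dimk U UL.
have [QD QZ] := Qcone; set p' := p + t *: v in Qp' UL *.
have vNp' : ~ face_dir Q p' v.
  move=> [c [c1 _]].
  have c0 : 0 < c.
    have := tauQ _ c1; rewrite linearD linearZ_LR /= tauv addr0.
    by rewrite pmulr_lgt0 ?tauQ.
  apply: (maxt (t + c^-1)); first by rewrite ltrDl invr_gt0.
  have ci0 : 0 < c^-1 by rewrite invr_gt0.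
  have := QZ _ _ ci0 c1.
  by rewrite scalerDr scalerA mulVf ?gt_eqF // scale1r scalerDl addrA.
have sub u : face_dir Q p' u -> face_dir Q p u.
  have [c [c1 c2]] := pv.
  (* Indeed [(1 + t c) p - p' = t (c p - v)]. *)
  apply: (@face_dir_sub _ _ _ (1 + t * c)) => //.
  rewrite /p' scalerDl scale1r opprD addrACA subrr add0r -scalerA -scalerBr.
  exact: QZ.
have vNU : v \notin U by apply/negP => /UL.
have v0 : v != 0 by apply: contraNneq vNU => ->; rewrite mem0v.
(* [U] and [v] together span directions at [p], one dimension more than [U]. *)
have := dimk (U + <[v]>)%VS; rewrite dimv_disjoint_sum; last first.
  apply/eqP; rewrite -subv0; apply/subvP => w /memv_capP [wU /vlineP [a wE]].
  have [a0|a0] := eqVneq a 0; first by rewrite wE a0 scale0r mem0v.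
  by case/negP: vNU; rewrite -[v](scalerK a0) -wE memvZ.
rewrite dim_vline v0 addn1 ltnS; apply=> u /memv_addP [u1 u1U [_ /vlineP [a ->] ->]].
apply: face_dirD => //; last exact: face_dirZ.
exact/sub/UL.
Qed.

(** Quantifying over cones [H] expresses generation by extreme rays without writing finite sums. The
    exit hypothesis takes the place of compactness of a base of [Q]. *)
Theorem cone_extreme_ray_ind Q tau H : is_cone Q -> is_cone H ->
    (forall q, Q q -> 0 < tau q) ->
    (forall p v, Q p -> v != 0 -> tau v = 0 -> Q (p + v) ->
      exists2 t : R, 0 < t & Q (p + t *: v) /\
        forall t', t < t' -> ~ Q (p + t' *: v)) ->
    (forall e, extreme_ray Q e -> H e) ->
  forall p, Q p -> H p.
Proof.
move=> Qcone [HD HZ] tauQ exitQ Hext p.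
have [QD QZ] := Qcone.
have : face_dim_le Q p (\dim {:F}) by move=> U _; rewrite dimvS ?subvf.
elim: (\dim _) p => [|k IH] p dimp Qp.
  (* The line through [p] consists of directions at [p], so in dimension 0 it vanishes, against
     [tau p > 0]. *)
  have := dimp <[p]>%VS; rewrite dim_vline leqn0 eqb0 negbK => p0.
  have /eqP p0' : p == 0.
    by apply: p0 => u /vlineP [a ->]; apply: face_dirZ => //; apply: face_dirxx.
  by have := tauQ _ Qp; rewrite p0' linear0 ltxx.
have exit v : face_dir Q p v -> v != 0 -> tau v = 0 ->
    exists2 t : R, 0 < t & H (p + t *: v).
  move=> pv v0 tauv; have [c [c1 _]] := pv.
  have c0 : 0 < c.
    have := tauQ _ c1; rewrite linearD linearZ_LR /= tauv addr0.
    by rewrite pmulr_lgt0 ?tauQ.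
  have ci0 : 0 < c^-1 by rewrite invr_gt0.
  (* Dividing [v] by [c] makes one full step stay in [Q], as [exitQ] demands. *)
  have [|||t t0 [Qt maxt]] := exitQ p (c^-1 *: v) Qp.
  - by rewrite scaler_eq0 invr_eq0 negb_or gt_eqF.
  - by rewrite linearZ_LR /= tauv scaler0.
  - have := QZ _ _ ci0 c1.
    by rewrite scalerDr scalerA mulVf ?gt_eqF // scale1r.
  exists (t / c); first exact: divr_gt0.
  rewrite -scalerA; apply: IH => //.
  apply: (@face_dim_exit _ tau) => //; first by rewrite linearZ_LR /= tauv scaler0.
  exact: face_dirZ.
have [ext|Next] := pselect (extreme_ray Q p); first exact: Hext.
have [q1 [q2 [Qq1 Qq2 pE q1N]]] : exists q1 q2,
    [/\ Q q1, Q q2, p = q1 + q2 & forall t : R, q1 <> t *: p].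
  apply: contrapT => nq; apply: Next; split=> // q1 q2 Qq1 Qq2 pE.
  apply: contrapT => nt; apply: nq; exists q1, q2; split=> // t tE.
  by apply: nt; exists t.
(* The multiple of [p] makes [tau v] vanish, and [v] is nonzero because [q1] is not a multiple of
   [p]. *)
pose v := q1 - (tau q1 / tau p) *: p.
have tauv : tau v = 0.
  rewrite /v linearB linearZ_LR /=; apply/eqP; rewrite subr_eq0; apply/eqP.
  by rewrite /GRing.scale /= divfK // gt_eqF // tauQ.
have v0 : v != 0 by apply/eqP => /subr0_eq; apply: q1N.
have pv : face_dir Q p v.
  rewrite /v -scaleNr; apply: face_dirD => //.
    by exists 1; rewrite scale1r {2}pE addrAC subrr add0r; split=> //; apply: QD.
  by apply: face_dirZ => //; apply: face_dirxx.
move: v v0 tauv pv => v v0 tauv pv.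
have [t t0 Ht] := exit v pv v0 tauv.
have [|||s s0] := exit (- v); last rewrite scalerN => Hs.
- by rewrite -scaleN1r; apply: face_dirZ.
- by rewrite oppr_eq0.
- by rewrite linearN /= tauv oppr0.
have st0 : 0 < s + t by apply: addr_gt0.
(* [p] lies between the two exit points; the weights cancel the terms in [v]. *)
have -> : p = (s / (s + t)) *: (p + t *: v) + (t / (s + t)) *: (p - s *: v).
  rewrite !scalerDr addrACA -scalerDl -mulrDl divff ?gt_eqF // scale1r.
  by rewrite !scalerN !scalerA mulrAC [t / _ * _]mulrAC [t * s]mulrC subrr addr0.
by apply: HD; apply: HZ => //; apply: divr_gt0.
Qed.

End ConeDecomposition.

(** * The cone of a matrix convex set *)

Section Compression.
Variables (C : numClosedFieldType) (V : lmodType C).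

Local Notation "a *ml x" := (lmul_mx a x).
Local Notation "x *mr b" := (rmul_mx x b).

Lemma lmul_mxA m n p q (a : 'M[C]_(m, n)) (b : 'M[C]_(n, p)) (x : 'M[V]_(p, q)) :
  (a *m b) *ml x = a *ml (b *ml x).
Proof.
apply/matrixP => i j; rewrite !mxE.
under eq_bigr do rewrite mxE scaler_suml.
rewrite exchange_big /=; apply: eq_bigr => k _; rewrite mxE scaler_sumr.
by apply: eq_bigr => l _; rewrite scalerA.
Qed.

Lemma rmul_mxA m n p q (x : 'M[V]_(m, n)) (a : 'M[C]_(n, p)) (b : 'M[C]_(p, q)) :
  x *mr (a *m b) = (x *mr a) *mr b.
Proof.
apply/matrixP => i j; rewrite !mxE.
under eq_bigr do rewrite mxE scaler_suml.
rewrite exchange_big /=; apply: eq_bigr => k _; rewrite mxE scaler_sumr.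
by apply: eq_bigr => l _; rewrite scalerA mulrC.
Qed.

Lemma lrmul_mxA m n p q (a : 'M[C]_(m, n)) (x : 'M[V]_(n, p)) (b : 'M[C]_(p, q)) :
  (a *ml x) *mr b = a *ml (x *mr b).
Proof.
apply/matrixP => i j; rewrite !mxE.
under eq_bigr do rewrite mxE scaler_sumr.
rewrite exchange_big /=; apply: eq_bigr => k _; rewrite mxE scaler_sumr.
by apply: eq_bigr => l _; rewrite !scalerA mulrC.
Qed.

Definition gram m n (g : 'M[C]_(m, n)) : 'M[C]_n := g^t* *m g.

Definition compr m n (g : 'M[C]_(m, n)) (x : 'M[V]_m) : 'M[V]_n :=
  g^t* *ml x *mr g.

Definition mx_scale (t : C) m n (x : 'M[V]_(m, n)) : 'M[V]_(m, n) :=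
  map_mx ( *:%R t) x.

Lemma comprE m n (g : 'M[C]_(m, n)) x i j :
  compr g x i j = \sum_k \sum_l ((g k i)^* * g l j) *: x k l.
Proof.
rewrite !mxE; under eq_bigr do rewrite mxE scaler_sumr.
rewrite exchange_big /=; apply: eq_bigr => k _; apply: eq_bigr => l _.
by rewrite !mxE scalerA mulrC.
Qed.

Lemma gramE m n (g : 'M[C]_(m, n)) i j : gram g i j = \sum_k (g k i)^* * g k j.
Proof. by rewrite mxE; apply: eq_bigr => k _; rewrite !mxE. Qed.

Lemma gramM m n p (g : 'M[C]_(m, n)) (h : 'M[C]_(n, p)) :
  gram (g *m h) = h^t* *m gram g *m h.
Proof. by rewrite /gram trmx_mul map_mxM !mulmxA. Qed.

Lemma comprM m n p (g : 'M[C]_(m, n)) (h : 'M[C]_(n, p)) x :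
  compr (g *m h) x = compr h (compr g x).
Proof.
by rewrite /compr trmx_mul map_mxM lmul_mxA rmul_mxA lrmul_mxA lrmul_mxA -!lrmul_mxA.
Qed.

Lemma compr1 n (x : 'M[V]_n) : compr 1%:M x = x.
Proof.
apply/matrixP => i j; rewrite comprE (bigD1 i) //= (bigD1 j) //= !mxE !eqxx.
rewrite rmorph1 mulr1 scale1r big1 ?addr0 ?big1 ?addr0 // => k ki.
  by rewrite big1 // => l _; rewrite mxE (negPf ki) rmorph0 mul0r scale0r.
by rewrite mxE (negPf ki) mulr0 scale0r.
Qed.

Lemma comprD m n (g : 'M[C]_(m, n)) x y : compr g (x + y) = compr g x + compr g y.
Proof.
apply/matrixP => i j; rewrite [RHS]mxE !comprE -big_split; apply: eq_bigr => k _ /=.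
by rewrite -big_split; apply: eq_bigr => l _ /=; rewrite mxE scalerDr.
Qed.

Lemma compr_sum m n (g : 'M[C]_(m, n)) (I : finType) (x : I -> 'M[V]_m) :
  compr g (\sum_i x i) = \sum_i compr g (x i).
Proof.
apply: (big_morph (compr g) (@comprD _ _ g)).
apply/matrixP => i j; rewrite comprE !mxE; apply: big1 => k _; apply: big1 => l _.
by rewrite mxE scaler0.
Qed.

Lemma compr0 m n (x : 'M[V]_m) : compr (0 : 'M[C]_(m, n)) x = 0.
Proof.
apply/matrixP => i j; rewrite comprE mxE; apply: big1 => k _.
by apply: big1 => l _; rewrite !mxE mulr0 scale0r.
Qed.

Lemma gramZ m n (c : C) (g : 'M[C]_(m, n)) : gram (c *: g) = (c^* * c) *: gram g.
Proof.
apply/matrixP => i j; rewrite [RHS]mxE !gramE mulr_sumr; apply: eq_bigr => k _.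
by rewrite !mxE rmorphM /= mulrACA.
Qed.

Lemma comprZ m n (c : C) (g : 'M[C]_(m, n)) x :
  compr (c *: g) x = mx_scale (c^* * c) (compr g x).
Proof.
apply/matrixP => i j; rewrite [RHS]mxE !comprE scaler_sumr; apply: eq_bigr => k _.
rewrite scaler_sumr; apply: eq_bigr => l _.
by rewrite !mxE rmorphM /= scalerA mulrACA.
Qed.

Lemma compr_scale m n (t : C) (g : 'M[C]_(m, n)) x :
  compr g (mx_scale t x) = mx_scale t (compr g x).
Proof.
apply/matrixP => i j; rewrite [RHS]mxE !comprE scaler_sumr; apply: eq_bigr => k _.
by rewrite scaler_sumr; apply: eq_bigr => l _; rewrite !mxE !scalerA mulrC.
Qed.

Lemma mx_scale1 m n (x : 'M[V]_(m, n)) : mx_scale 1 x = x.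
Proof. by apply/matrixP => i j; rewrite mxE scale1r. Qed.

Lemma mx_scaleA m n s t (x : 'M[V]_(m, n)) :
  mx_scale s (mx_scale t x) = mx_scale (s * t) x.
Proof. by apply/matrixP => i j; rewrite !mxE scalerA. Qed.

Lemma gram_col_mx m p n (g : 'M[C]_(m, n)) (h : 'M[C]_(p, n)) :
  gram (col_mx g h) = gram g + gram h.
Proof. by rewrite /gram tr_col_mx map_row_mx mul_row_col. Qed.

Lemma gram_row_mx1 m p :
  gram (row_mx 1%:M 0 : 'M[C]_(m, m + p)) + gram (row_mx 0 1%:M) = 1%:M.
Proof.
rewrite /gram !tr_row_mx !map_col_mx !mul_col_row add_block_mx.
rewrite !trmx0 !trmx1 !map_mx0 !map_mx1 !mul0mx !mulmx0 !mulmx1.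
by rewrite !addr0 !add0r -scalar_mx_block.
Qed.

(** The sum inside the left-hand side is the block diagonal direct sum of [x1] and [x2]. *)
Lemma compr_dsum m p n (g1 : 'M[C]_(m, n)) (g2 : 'M[C]_(p, n)) x1 x2 :
  compr (col_mx g1 g2) (compr (row_mx 1%:M 0) x1 + compr (row_mx 0 1%:M) x2) =
  compr g1 x1 + compr g2 x2.
Proof.
rewrite comprD -!comprM !mul_row_col.
by rewrite !mul1mx !mul0mx addr0 add0r.
Qed.

Lemma mxtrace_gram m n (g : 'M[C]_(m, n)) :
  \tr (gram g) = \sum_i \sum_j `|g j i| ^+ 2.
Proof.
apply: eq_bigr => i _; rewrite gramE; apply: eq_bigr => j _.
by rewrite normCKC.
Qed.

Lemma mxtrace_gram_gt0 m n (g : 'M[C]_(m, n)) : g != 0 -> 0 < \tr (gram g).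
Proof.
move=> g0; have ge0 i j : 0 <= `|g j i| ^+ 2 by rewrite exprn_ge0.
rewrite mxtrace_gram lt_def sumr_ge0 ?andbT => [|i _]; last exact: sumr_ge0.
apply: contra_neq g0 => /psumr_eq0P H; apply/matrixP => j i; rewrite mxE.
have /psumr_eq0P -/(_ _ j erefl) := H (fun i _ => sumr_ge0 _ (fun j _ => ge0 i j)) i erefl.
by move=> /(_ (fun j _ => ge0 i j))/eqP; rewrite sqrf_eq0 normr_eq0 => /eqP.
Qed.

(** Gram-Schmidt turns the rows of [b] into orthonormal rows whose span contains the rows of the
    adjoint of [g]; the adjoint [w] of that matrix is an isometry whose range contains that of
    [g]. *)
Lemma orthonormal_factor m n k (b : 'M[C]_(k, m)) (g : 'M[C]_(m, n)) :
  (k <= m)%N -> (g^t* <= b)%MS ->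
  exists (w : 'M[C]_(m, k)) (h : 'M[C]_(k, n)), gram w = 1%:M /\ g = w *m h.
Proof.
move=> km gb; have ub := schmidt_unitarymx b km.
have /submxP [d dE] := submx_trans gb (schmidt_sub b).
exists ((schmidt b)^t*), (d^t*); split; first by rewrite /gram trmxCK; apply/unitarymxP.
by rewrite -(trmxCK g) dE trmx_mul map_mxM.
Qed.

End Compression.

(** * Closure properties and representatives of the cone *)

Section MatrixCone.
Variables (C : numClosedFieldType) (V : lmodType C) (X : mx_family V).
Arguments X : clear implicits.
Hypothesis convexX : matrix_convex X.

Lemma matrix_convex_compr r n (w : 'M[C]_(r.+1, n.+1)) (x : 'M[V]_r.+1) :
  X r x -> gram w = 1%:M -> X n (compr w x).
Proof.
move=> Xx w1; apply: (convexX (s := 1) (m := fun=> r) (g := fun=> w)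
  (x := fun=> x)) => //.
by split; rewrite big_ord1.
Qed.

Lemma matrix_convex2 r1 r2 n (g1 : 'M[C]_(r1.+1, n.+1))
    (g2 : 'M[C]_(r2.+1, n.+1)) (x1 : 'M[V]_r1.+1) (x2 : 'M[V]_r2.+1) :
  X r1 x1 -> X r2 x2 -> gram g1 + gram g2 = 1%:M ->
  X n (compr g1 x1 + compr g2 x2).
Proof.
move=> Xx1 Xx2 g12.
(* Dependent pairs allow a family over ['I_2] whose matrix sizes differ. *)
pose T := {r : nat & ('M[C]_(r.+1, n.+1) * 'M[V]_r.+1)%type}.
pose t1 : T := existT _ r1 (g1, x1); pose t2 : T := existT _ r2 (g2, x2).
pose f (i : 'I_2) := if i == ord0 then t1 else t2.
apply: (convexX (s := 2) (m := fun i => tag (f i))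
  (g := fun i => (tagged (f i)).1) (x := fun i => (tagged (f i)).2)).
  by move=> i; rewrite /f; case: ifP.
by split; rewrite big_ord_recl big_ord1.
Qed.

(** The index [r1 + r2.+1] stands for the size [r1.+1 + r2.+1], to which its successor is
    convertible. *)
Lemma matrix_convex_dsum r1 r2 (x1 : 'M[V]_r1.+1) (x2 : 'M[V]_r2.+1) :
  X r1 x1 -> X r2 x2 ->
  exists2 x, X (r1 + r2.+1) x & forall n (g1 : 'M[C]_(r1.+1, n))
    (g2 : 'M[C]_(r2.+1, n)), compr (col_mx g1 g2) x = compr g1 x1 + compr g2 x2.
Proof.
move=> Xx1 Xx2.
exists (compr (row_mx 1%:M 0) x1 + compr (row_mx 0 1%:M) x2).
  by apply: matrix_convex2 => //; exact: (gram_row_mx1 C r1.+1 r2.+1).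
by move=> n g1 g2; apply: compr_dsum.
Qed.

(** With [g] nonzero the trace of the first component is positive, so 0 is excluded. *)
Definition mx_cone n (p : 'M[C]_n.+1 * 'M[V]_n.+1) : Prop :=
  exists r (g : 'M[C]_(r.+1, n.+1)) x,
    [/\ X r x, g != 0 & p = (gram g, compr g x)].

Lemma mx_coneD n (p q : 'M[C]_n.+1 * 'M[V]_n.+1) :
  mx_cone p -> mx_cone q -> mx_cone (p + q).
Proof.
move=> [r1 [g1 [x1 [Xx1 g10 ->]]]] [r2 [g2 [x2 [Xx2 g20 ->]]]].
have [x Xx xE] := matrix_convex_dsum Xx1 Xx2.
exists (r1 + r2.+1)%N, (col_mx g1 g2), x; split=> //.
  apply: contra g10 => g0; have : col_mx g1 g2 == 0 := g0.
  by rewrite col_mx_eq0 => /andP[].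
by rewrite xE; congr pair; rewrite -gram_col_mx.
Qed.

Lemma mx_coneZ n (t : C) (p : 'M[C]_n.+1 * 'M[V]_n.+1) :
  0 < t -> mx_cone p -> mx_cone (t *: p.1, mx_scale t p.2).
Proof.
move=> t0 [r [g [x [Xx g0 ->]]]]; exists r, (sqrtC t *: g), x.
have s0 : 0 < sqrtC t by rewrite sqrtC_gt0.
rewrite scaler_eq0 gt_eqF // g0 gramZ comprZ.
by rewrite (CrealP (gtr0_real s0)) -expr2 sqrtCK.
Qed.

(** Factor [g = w h] through its range, with [w] an isometry, and replace [x] by its compression
    along [w]; then [h] has full row rank. *)
Lemma mx_cone_onto n (p : 'M[C]_n.+1 * 'M[V]_n.+1) : mx_cone p ->
  exists r (g : 'M[C]_(r.+1, n.+1)) x h,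
    [/\ X r x, g *m h = 1%:M & p = (gram g, compr g x)].
Proof.
move=> [m [g [x [Xx g0 ->]]]].
have : (g^t* <= row_base (g^t*))%MS by rewrite eq_row_base.
have rg : \rank (g^t*) = \rank g by rewrite mxrank_map mxrank_tr.
have : \rank (g^t*) != 0%N by rewrite rg mxrank_eq0.
have : (\rank (g^t*) <= m.+1)%N by rewrite rank_leq_col.
(* The rank becomes a variable [k]; it is a successor because [g] is nonzero, as positive sizes
   require. *)
move: (row_base _); rewrite {}rg; move krank : (\rank g) => k.
case: k krank => // k krank b km _ /(orthonormal_factor km) [w [h [w1 gE]]].
have : row_free h.
  rewrite /row_free eqn_leq rank_leq_row /=.
  by apply: leq_trans (mxrankM_maxr w h); rewrite -gE krank.
move=> /row_freeP [h' hh']; exists k, h, (compr w x), h'; split=> //.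
  exact: matrix_convex_compr.
by rewrite -comprM -gE gE gramM w1 mulmx1.
Qed.

(** A representative over the single set [X n] is what lets the compactness of [X n] be applied to
    the whole cone. *)
Lemma mx_cone_square n x0 (p : 'M[C]_n.+1 * 'M[V]_n.+1) : X n x0 -> mx_cone p ->
  exists (g : 'M[C]_n.+1) x, X n x /\ p = (gram g, compr g x).
Proof.
move=> Xx0 [m [g [x [Xx g0 ->]]]].
(* Padding by [x0] makes the size at least [n.+1] before compressing. *)
have [y Xy yE] := matrix_convex_dsum Xx0 Xx.
have nm : (n.+1 <= n.+1 + m.+1)%N by rewrite leq_addr.
pose g' : 'M[C]_(n.+1 + m.+1, n.+1) := col_mx 0 g.
have [w [h [w1 gE]]] := orthonormal_factor nm (submx_refl (g'^t*)).
exists h, (compr w y); split; first exact: matrix_convex_compr.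
rewrite -comprM -gE yE.
have -> : gram h = gram g' by rewrite gE gramM w1 mulmx1.
by rewrite gram_col_mx compr0 /gram mulmx0 !add0r.
Qed.

End MatrixCone.

(** * Extreme rays yield matrix extreme points *)

Section ExtremeRays.
Variables (C : numClosedFieldType) (V : lmodType C) (X : mx_family V).
Arguments X : clear implicits.

Lemma onto_mulmx_inverse m n (g : 'M[C]_(m, n)) :
    (forall w : 'cV[C]_m, exists v : 'cV[C]_n, g *m v = w) ->
  exists h, g *m h = 1%:M.
Proof.
move=> /choice [f fE]; exists (\matrix_(i, j) f (col j 1%:M) i 0).
apply/matrixP => i j; have /matrixP/(_ i 0) := fE (col j 1%:M).
by rewrite !mxE => <-; apply: eq_bigr => l _; rewrite !mxE.
Qed.

(** The Gram matrix [c] is invertible, so [g] is injective as well as onto, hence square; dividing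
    it by the square root of [c] gives a unitary, whose adjoint is the witness. *)
Lemma unitarily_equivalent k r (c : C) (g : 'M[C]_(k.+1, r.+1)) h
    (x : 'M[V]_k.+1) (y : 'M[V]_r.+1) :
    g *m h = 1%:M -> gram g = c%:M -> compr g x = mx_scale c y ->
  exists (e : k = r) (u : 'M[C]_r.+1), u \is unitarymx /\
    castmx (congr1 S e, congr1 S e) x = compr u y.
Proof.
move=> gh gc xy.
have g0 : g != 0.
  by apply: contra_eq_neq gh => ->; rewrite mul0mx eq_sym matrix_nonzero1.
have c0 : 0 < c.
  have := mxtrace_gram_gt0 g0; rewrite gc mxtrace_scalar -mulr_natr.
  by rewrite pmulr_lgt0 ?ltr0Sn.
have e : k = r.
  apply/eqP; rewrite -eqSS eqn_leq; apply/andP; split.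
    rewrite -[k.+1](mxrank1 C) -gh; apply: leq_trans (mxrankM_maxl _ _) _.
    exact: rank_leq_col.
  have <- : \rank (c%:M : 'M[C]_r.+1) = r.+1.
    by rewrite mxrank_unit // unitmxE det_scalar unitrX // unitfE gt_eqF.
  by rewrite -gc; apply: leq_trans (mxrankM_maxr _ _) (rank_leq_row _).
case: r / e y g h gh gc xy g0 => y g h gh gc xy g0.
pose s := sqrtC c; have s0 : s != 0 by rewrite sqrtC_eq0 gt_eqF.
have ss : (s^-1)^* * s^-1 = c^-1.
  rewrite (CrealP _) ?rpredV ?gtr0_real ?sqrtC_gt0 //.
  by rewrite -invfM -expr2 sqrtCK.
have ci : c^-1 * c = 1 by rewrite mulVf ?gt_eqF.
pose u := s^-1 *: g.
have uu : u^t* *m u = 1%:M.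
  by rewrite -/(gram u) gramZ ss gc scale_scalar_mx ci.
exists erefl, (u^t*); split.
  by apply/unitarymxP; rewrite trmxCK.
have <- : compr u x = y by rewrite comprZ ss xy mx_scaleA ci mx_scale1.
by rewrite castmx_id -comprM (mulmx1C uu) compr1.
Qed.

Lemma matrix_extreme_of_extreme_ray r n (g : 'M[C]_(r.+1, n.+1)) h x :
    X r x -> g *m h = 1%:M ->
    (forall p q, mx_cone X p -> mx_cone X q -> (gram g, compr g x) = p + q ->
      exists t : C, p = (t *: gram g, mx_scale t (compr g x))) ->
    matrix_convex X ->
  matrix_extreme X r x.
Proof.
move=> Xx gh ext convexX; split=> // s m gs xs Xxs [gs1 xE] proper i.
have [hi ghi] := onto_mulmx_inverse (proper i).
(* Composing the coefficients with [g] turns the combination for [x] into a decomposition of the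
   pair on the ray. *)
pose q j := (gram (gs j *m g), compr (gs j *m g) (xs j)).
have Qq j : mx_cone X (q j).
  exists (m j), (gs j *m g), (xs j); split=> //.
  have [hj ghj] := onto_mulmx_inverse (proper j).
  apply/eqP => /(congr1 (mulmx^~ (h *m hj))).
  rewrite mul0mx -mulmxA [g *m _]mulmxA gh mul1mx ghj => /eqP.
  by rewrite (negPf (matrix_nonzero1 _ _)).
have qE : (gram g, compr g x) = \sum_j q j.
  rewrite [RHS]surjective_pairing (big_morph fst (id1 := 0) (op1 := +%R)) //.
  rewrite (big_morph snd (id1 := 0) (op1 := +%R)) //; congr pair => /=.
    under eq_bigr do rewrite gramM.
    by rewrite -mulmx_suml -mulmx_sumr gs1 mulmx1.
  under eq_bigr do rewrite comprM.
  by rewrite -compr_sum xE.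
(* Splitting off only half of [q i] keeps the remainder in the cone even when
   [i] is the only index. *)
have half : 2^-1 + 2^-1 = 1 :> C by rewrite -[2^-1]mul1r -splitr.
have t0 : 0 < 2^-1 :> C by rewrite invr_gt0 ltr0Sn.
pose q' : 'M[C]_n.+1 * 'M[V]_n.+1 := (2^-1 *: (q i).1, mx_scale 2^-1 (q i).2).
have Qq' : mx_cone X q' by apply: mx_coneZ.
have q'D : q' + q' = q i.
  rewrite [RHS]surjective_pairing; congr pair => /=.
    by rewrite -scalerDl half scale1r.
  by apply/matrixP => a b; rewrite !mxE -scalerDl half scale1r.
have Qrest : mx_cone X (q' + \sum_(j | j != i) q j).
  apply: (big_rec (fun p => mx_cone X (q' + p))); first by rewrite addr0.
  by move=> j p _ Qp; rewrite addrCA; apply: mx_coneD.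
have [|t [tE1 tE2]] := ext _ _ Qq' Qrest.
  by rewrite addrA q'D qE (bigD1 i).
have two : 2 * 2^-1 = 1 :> C by rewrite divff // pnatr_eq0.
(* The factor 2 undoes the halving of [q i], and compressing by the right inverse [h] cancels
   [g]. *)
apply: (unitarily_equivalent (c := 2 * t) ghi).
  have := congr1 (fun a => h^t* *m (2 *: a) *m h) tE1.
  rewrite !scalerA two scale1r -gramM -mulmxA gh mulmx1 => ->.
  by rewrite -scalemxAr -scalemxAl -gramM gh /gram trmx1 map_mx1 mulmx1 scalemx1.
have := congr1 (fun a => compr h (mx_scale 2 a)) tE2.
by rewrite !mx_scaleA two mx_scale1 compr_scale -!comprM -mulmxA gh mulmx1 compr1.
Qed.

End ExtremeRays.

(** * Compactness *)

Section Topology.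

Lemma mx_coord_continuous (T : topologicalType) m n i j :
  continuous (fun M : 'M[T]_(m, n) => M i j).
Proof.
move=> M s sM.
exists (fun k l => [set y | k = i -> l = j -> s y]) => [k l /=|N MN /=].
  have [[-> ->]|kl] := pselect (k = i /\ l = j); first by apply: filterS sM => y sy _ _.
  by apply: filterE => y ki lj; case: kl.
exact: MN.
Qed.

Section TvsContinuous.
Variables (K : numDomainType) (E : tvsType K) (T : topologicalType).

Lemma tvs_continuousD (f g : T -> E) :
  continuous f -> continuous g -> continuous (fun z => f z + g z).
Proof.
move=> cf cg z.
apply: (@continuous_comp T (E * E)%type E (fun z => (f z, g z))
  (fun x => x.1 + x.2)); last exact: add_continuous.
exact: (cvg_pair (cf z) (cg z)).
Qed.

Lemma tvs_continuousZ (c : T -> K^o) (f : T -> E) :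
  continuous c -> continuous f -> continuous (fun z => c z *: f z).
Proof.
move=> cc cf z.
apply: (@continuous_comp T (K^o * E)%type E (fun z => (c z, f z))
  (fun x => x.1 *: x.2)); last exact: scale_continuous.
exact: (cvg_pair (cc z) (cf z)).
Qed.

Lemma tvs_continuous_sum (I : finType) (f : I -> T -> E) :
  (forall i, continuous (f i)) -> continuous (fun z => \sum_i f i z).
Proof.
move=> cf; elim: (index_enum I) => [|i s IH].
  by under eq_fun do rewrite big_nil; apply: cst_continuous.
by under eq_fun do rewrite big_cons; apply: tvs_continuousD.
Qed.

Lemma closed_eq_continuous (f g : T -> E) : hausdorff_space E ->
  continuous f -> continuous g -> closed [set z | f z = g z].
Proof.
move=> hE cf cg.
rewrite (_ : mkset _ = (fun z => f z + (-1) *: g z) @^-1` [set 0]).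
  apply: preimage_closed => [z _|]; last first.
    exact/accessible_closed_set1/hausdorff_accessible.
  by apply: tvs_continuousD => //; apply: tvs_continuousZ => // ?; apply: cst_continuous.
apply/seteqP; split=> z /=; rewrite scaleN1r; first by move=> ->; rewrite subrr.
exact: subr0_eq.
Qed.

(** Equations of this shape, with [c] the inverse step length, define the exit point below. *)
Lemma closed_scale_eq (c : T -> K^o) (f : T -> E) (y w : E) :
  hausdorff_space E -> continuous c -> continuous f ->
  closed [set z | c z *: f z = c z *: y + w].
Proof.
move=> hE cc cf; apply: closed_eq_continuous => //; first exact: tvs_continuousZ.
apply: tvs_continuousD; last exact: cst_continuous.
by apply: tvs_continuousZ => //; apply: cst_continuous.
Qed.

End TvsContinuous.

Lemma closed_mul_eq (K : numFieldType) (T : topologicalType) (c f : T -> K^o)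
    (y w : K) : continuous c -> continuous f ->
  closed [set z | c z * f z = c z * y + w].
Proof.
by move=> cc cf; apply: (@closed_scale_eq K K^o) => //; apply: norm_hausdorff.
Qed.

Section ComplexContinuous.
Variables (R : realType) (T : topologicalType).

Lemma real_complex_continuous : continuous (fun a : R => a%:C%C : R[i]^o).
Proof.
move=> a s /nbhs_ballP [e /= e0 es].
have re0 : 0 < complex.Re e by move: e0; rewrite ltcE => /andP[].
apply/nbhs_ballP; exists (complex.Re e) => // b ab; apply: es.
move: ab; rewrite /ball /= -rmorphB /= normc_def /=.
rewrite expr0n addr0 sqrtr_sqr.
by move: e0; rewrite !ltcE /= => /andP[/eqP -> _] ->; rewrite eqxx.
Qed.

Lemma complex_continuous (a b : T -> R) : continuous a -> continuous b ->
  continuous (fun z => Complex (a z) (b z) : R[i]^o).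
Proof.
move=> ca cb.
have cC (f : T -> R) : continuous f -> continuous (fun z => (f z)%:C%C : R[i]^o).
  move=> cf z; apply: (@continuous_comp T R R[i]^o f (fun a => a%:C%C)).
    exact: cf.
  exact: real_complex_continuous.
rewrite (_ : (fun z => _) =
    fun z => (a z)%:C%C *: (1 : R[i]^o) + (b z)%:C%C *: ('i%C : R[i]^o)).
  apply: tvs_continuousD; apply: tvs_continuousZ; try exact: cC;
    exact: cst_continuous.
by apply/funext => z; rewrite /GRing.scale /=; simpc.
Qed.

End ComplexContinuous.
End Topology.

(** * Leaving the cone along a trace-zero direction *)

Section ExitPoint.
Variables (R : realType) (V : vectTvsType R[i]).

(** Real row vectors parametrize complex matrices, so that a compact set of coefficients is a
    product of real intervals. *)
Definition complex_mx n (a b : 'rV[R]_(n * n)) : 'M[R[i]]_n :=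
  \matrix_(i, j) Complex (a 0 (mxvec_index i j)) (b 0 (mxvec_index i j)).

Lemma complex_mxE n (g : 'M[R[i]]_n) :
  g = complex_mx (mxvec (map_mx (@complex.Re R) g)) (mxvec (map_mx (@complex.Im R) g)).
Proof. by apply/matrixP => i j; rewrite !mxE !mxvecE !mxE; case: (g i j). Qed.

Section Continuity.
Variables (T : topologicalType) (n : nat) (a b : T -> 'rV[R]_(n * n)).
Hypotheses (ca : continuous a) (cb : continuous b).

Let coord_comp (f : T -> 'rV[R]_(n * n)) k :
  continuous f -> continuous (fun z => f z 0 k).
Proof.
move=> cf z; apply: (@continuous_comp _ _ _ f (fun u => u 0 k)).
  exact: cf.
exact: mx_coord_continuous.
Qed.

Let entry_continuous i j :
  continuous (fun z => complex_mx (a z) (b z) i j : R[i]^o).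
Proof.
under eq_fun do rewrite mxE.
by apply: complex_continuous; apply: coord_comp.
Qed.

Let conj_entry_continuous i j :
  continuous (fun z => (complex_mx (a z) (b z) i j)^* : R[i]^o).
Proof.
under eq_fun do rewrite mxE.
apply: complex_continuous; first exact: coord_comp.
by move=> z; apply: continuousN; apply: coord_comp.
Qed.

Lemma gram_continuous i j :
  continuous (fun z => gram (complex_mx (a z) (b z)) i j : R[i]^o).
Proof.
under eq_fun do rewrite gramE.
by apply: tvs_continuous_sum => k; apply: tvs_continuousZ.
Qed.

Lemma compr_continuous (x : T -> 'M[V]_n) i j : continuous x ->
  continuous (fun z => compr (complex_mx (a z) (b z)) (x z) i j).
Proof.
move=> cx; under eq_fun do rewrite comprE.
apply: tvs_continuous_sum => k; apply: tvs_continuous_sum => l.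
apply: tvs_continuousZ; first exact: tvs_continuousZ.
move=> z; apply: (@continuous_comp _ _ _ x (fun M => M k l)); first exact: cx.
exact: mx_coord_continuous.
Qed.

End Continuity.

(** The cruder bound [1 + c] avoids the square root of [c]. *)
Lemma le_1D_of_sqr_le (a b c : R) : a ^+ 2 + b ^+ 2 <= c -> - (1 + c) <= a <= 1 + c.
Proof. by move=> abc; apply/andP; split; nra. Qed.

(** The trace of the Gram matrix is the sum of the squared moduli of all entries. *)
Lemma gram_entry_le m n (g : 'M[R[i]]_(m, n)) i j :
  complex.Re (g i j) ^+ 2 + complex.Im (g i j) ^+ 2 <= complex.Re (\tr (gram g)).
Proof.
rewrite mxtrace_gram.
under eq_bigr do under eq_bigr do rewrite -add_Re2_Im2.
under eq_bigr do rewrite -rmorph_sum /=.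
rewrite -rmorph_sum /= (bigD1 j) //= (bigD1 i) //= -addrA lerDl addr_ge0 //.
  by apply: sumr_ge0 => k _; rewrite addr_ge0 ?sqr_ge0.
by apply: sumr_ge0 => k _; apply: sumr_ge0 => l _; rewrite addr_ge0 ?sqr_ge0.
Qed.

Definition rscale n (t : R) (v : 'M[R[i]]_n * 'M[V]_n) :=
  (t%:C%C *: v.1, mx_scale t%:C%C v.2).

Lemma mx_cone_exit (X : mx_family V) n x0
    (p v : 'M[R[i]]_n.+1 * 'M[V]_n.+1) :
    hausdorff_space V -> (forall k, compact (X k)) -> matrix_convex X -> X n x0 ->
    mx_cone X p -> v != 0 -> \tr v.1 = 0 -> mx_cone X (p + v) ->
  exists2 t : R, 0 < t & mx_cone X (p + rscale t v) /\
    forall t', t < t' -> ~ mx_cone X (p + rscale t' v).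
Proof.
move=> hV cX convX Xx0 Qp v0 trv Qpv.
(* The largest [t] is found as the inverse of the least [s = 1 / t] solving
   [s (gram g, compr g x) = s p + v]; these equations cut a closed set out of a
   compact one, since the trace bounds the entries of [g], and [s = 0] is
   excluded because [v != 0]. *)
pose M := 1 + complex.Re (\tr p.1).
have trp0 : 0 < \tr p.1.
  by have [r [g [x [_ g0 ->]]]] := Qp; apply: mxtrace_gram_gt0.
pose N := (n.+1 * n.+1)%N.
pose T := (R * ('rV[R]_N * ('rV[R]_N * 'M[V]_n.+1)))%type.
pose box := [set u : 'rV[R]_N | forall i, (`[- M, M] : set R) (u ord0 i)].
(* A point lists [s], the real and imaginary parts of [g], and [x]. Restricting to [s <= 1] is
   harmless: the step [t = 1] is already admissible. *)
pose K : set T := `[0, 1] `*` (box `*` (box `*` X n)).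
have cK : compact K.
  have cbox : compact box.
    by apply: (@rV_compact R N (fun=> (`[- M, M] : set R))) => _;
      apply: segment_compact.
  apply: compact_setX; first exact: segment_compact.
  by apply: compact_setX => //; apply: compact_setX.
pose G (z : T) := complex_mx z.2.1 z.2.2.1.
pose D1 (ij : 'I_n.+1 * 'I_n.+1) := [set z : T |
  z.1%:C%C * gram (G z) ij.1 ij.2 = z.1%:C%C * p.1 ij.1 ij.2 + v.1 ij.1 ij.2].
pose D2 (ij : 'I_n.+1 * 'I_n.+1) := [set z : T |
  z.1%:C%C *: compr (G z) z.2.2.2 ij.1 ij.2 =
  z.1%:C%C *: p.2 ij.1 ij.2 + v.2 ij.1 ij.2].
pose D : set T := \bigcap_ij (D1 ij `&` D2 ij).
have c1 : continuous (fun z : T => z.1) by move=> z; apply: cvg_fst.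
have c2 : continuous (fun z : T => z.2) by move=> z; apply: cvg_snd.
have c21 : continuous (fun z : T => z.2.1).
  by move=> z; apply: (continuous_comp (c2 z)); apply: cvg_fst.
have c22 : continuous (fun z : T => z.2.2).
  by move=> z; apply: (continuous_comp (c2 z)); apply: cvg_snd.
have c221 : continuous (fun z : T => z.2.2.1).
  by move=> z; apply: (continuous_comp (c22 z)); apply: cvg_fst.
have c222 : continuous (fun z : T => z.2.2.2).
  by move=> z; apply: (continuous_comp (c22 z)); apply: cvg_snd.
have c1C : continuous (fun z : T => z.1%:C%C : R[i]^o).
  by move=> z; apply: (continuous_comp (c1 z)); apply: real_complex_continuous.
have cD : closed D.
  apply: closed_bigI => ij _; apply: closedI.
    rewrite /D1.
    have := @closed_mul_eq R[i] T (fun z => z.1%:C%C)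
      (fun z => gram (G z) ij.1 ij.2) (p.1 ij.1 ij.2) (v.1 ij.1 ij.2).
    move=> /(_ c1C).
    apply.
    exact: gram_continuous.
  apply: (@closed_scale_eq R[i] V T (fun z => z.1%:C%C)
    (fun z => compr (G z) z.2.2.2 ij.1 ij.2)) => //.
  exact: compr_continuous.
have KDP (s : R) : 0 < s -> s <= 1 -> mx_cone X (p + rscale s^-1 v) ->
    exists2 z, (K `&` D) z & z.1 = s.
  move=> s0 s1 /(mx_cone_square convX Xx0) [g [x [Xx gE]]].
  have gram_g : gram g = p.1 + s^-1%:C%C *: v.1 by have := congr1 fst gE.
  have compr_g : compr g x = p.2 + mx_scale s^-1%:C%C v.2 by have := congr1 snd gE.
  have ssC : s%:C%C * s^-1%:C%C = 1 by rewrite -rmorphM mulfV ?gt_eqF.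
  pose z : T := (s, (mxvec (map_mx (@complex.Re R) g),
    (mxvec (map_mx (@complex.Im R) g), x))).
  have Gz : G z = g by rewrite [RHS]complex_mxE.
  exists z => //; split; first split; rewrite /= ?in_itv /=.
  - by rewrite ltW.
  - have bound i j := gram_entry_le g i j.
    rewrite gram_g raddfD /= mxtraceZ trv mulr0 addr0 in bound.
    split; last split => //.
      case/mxvec_indexP => i j; rewrite mxvecE mxE /= in_itv /=.
      exact: le_1D_of_sqr_le (bound i j).
    case/mxvec_indexP => i j; rewrite mxvecE mxE /= in_itv /=.
    by apply: le_1D_of_sqr_le; rewrite addrC; apply: bound.
  - move=> ij _; split; rewrite /D1 /D2 /= Gz.
      by rewrite gram_g !mxE mulrDr mulrA ssC mul1r.
    by rewrite /z /= compr_g !mxE scalerDr scalerA ssC scale1r.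
have KDN z : (K `&` D) z -> 0 < z.1 /\ mx_cone X (p + rscale z.1^-1 v).
  move=> [[/= z01 [_ [_ Xz]]] Dz].
  have /andP[z0 z1] : 0 <= z.1 <= 1 by move: z01; rewrite in_itv.
  have {z0 z1 z01} z0 : 0 < z.1.
    rewrite lt_def z0 andbT; apply: contra_neq v0 => z10.
    rewrite [v]surjective_pairing; congr pair; apply/matrixP => i j; rewrite mxE.
      have [/= + _] := Dz (i, j) I.
      by rewrite /D1 /= z10 !mul0r add0r => <-.
    have [_ /=] := Dz (i, j) I.
    by rewrite /D2 /= z10 !scale0r add0r => <-.
  have ssC : z.1^-1%:C%C * z.1%:C%C = 1 by rewrite -rmorphM mulVf ?gt_eqF.
  have gram_z : gram (G z) = p.1 + z.1^-1%:C%C *: v.1.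
    apply/matrixP => i j; have [/= + _] := Dz (i, j) I.
    rewrite /D1 /= => /(congr1 ( *%R z.1^-1%:C%C)).
    by rewrite mulrDr !mulrA ssC !mul1r => ->; rewrite !mxE.
  split=> //; exists n, (G z), z.2.2.2; split=> //.
    (* The Gram matrix has the trace of [p.1], which is positive. *)
    apply/eqP => G0; move: gram_z; rewrite G0 /gram mulmx0 => /(congr1 mxtrace).
    rewrite raddfD /= mxtraceZ trv mulr0 addr0 mxtrace0 => /esym/eqP.
    by rewrite gt_eqF.
  rewrite [LHS]surjective_pairing; congr pair => //=.
  apply/matrixP => i j; have [_ /=] := Dz (i, j) I.
  rewrite /D2 /= => /(congr1 ( *:%R z.1^-1%:C%C)).
  by rewrite scalerDr !scalerA ssC !scale1r => ->; rewrite !mxE.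
(* Solutions exist: [p + v] in the cone provides one with [s = 1]. *)
have [|||z /set_mem KDz zmin] := @compact_EVT_min T R (fun z => z.1) (K `&` D).
- have [|||z ? _] := KDP 1; [exact: ltr01|exact: lexx| |by exists z].
  rewrite invr1 (_ : rscale 1 v = v) // [RHS]surjective_pairing /rscale.
  by rewrite scale1r mx_scale1.
- exact: compact_closedI.
- exact: continuous_subspaceT.
have [z0 Qz] := KDN z KDz; exists z.1^-1; first by rewrite invr_gt0.
split=> // t' tt' Qt'.
have t'0 : 0 < t' by apply: lt_trans tt'; rewrite invr_gt0.
(* A longer step [t'] would give a solution below the minimum. *)
have tz : t'^-1 < z.1 by rewrite invf_plt.
have /andP[_ z1] : 0 <= z.1 <= 1 by have [[]] := KDz; rewrite /= in_itv.
have [|||z' KDz' z'E] := KDP t'^-1.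
- by rewrite invr_gt0.
- exact: ltW (lt_le_trans tz z1).
- by rewrite invrK.
have := zmin z' (mem_set KDz').
by rewrite z'E leNgt tz.
Qed.
End ExitPoint.

(** * Real coordinates *)

Section RealCoordinates.
Variables (R : realType) (V : vectTvsType R[i]) (n : nat).
Implicit Types p q : 'M[R[i]]_n.+1 * 'M[V]_n.+1.

Definition cpart (b : bool) (z : R[i]) : R := if b then complex.Re z else complex.Im z.

Lemma cpartD b z w : cpart b (z + w) = cpart b z + cpart b w.
Proof. by case: b z w => -[? ?] [? ?]. Qed.

Lemma cpartZ b (t : R) z : cpart b (t%:C%C * z) = t * cpart b z.
Proof. by case: b z => -[? ?]; simpc. Qed.

Lemma cpart_inj z w : (forall b, cpart b z = cpart b w) -> z = w.
Proof.
by case: z w => [a b] [c d] zw; move: (zw true) (zw false) => /= -> ->.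
Qed.

Definition coord_index : finType :=
  ('I_n.+1 * 'I_n.+1 * bool + 'I_n.+1 * 'I_n.+1 * 'I_(\dim {:V}) * bool)%type.

(** An injective real-linear map from pairs to a real vector space of finite dimension, where the
    cone theorem applies. *)
Definition real_coords p : {ffun coord_index -> R^o} :=
  [ffun k => match k with
   | inl (i, j, b) => cpart b (p.1 i j)
   | inr (i, j, k, b) => cpart b (coord (vbasis {:V}) k (p.2 i j))
   end].

Lemma real_coordsD p q : real_coords (p + q) = real_coords p + real_coords q.
Proof.
apply/ffunP => -[[[i j] b]|[[[i j] k] b]]; rewrite !ffunE /= mxE.
  by rewrite cpartD.
by rewrite linearD cpartD.
Qed.

Lemma real_coordsZ (t : R) p : real_coords (rscale t p) = t *: real_coords p.
Proof.
apply/ffunP => -[[[i j] b]|[[[i j] k] b]]; rewrite !ffunE /= mxE.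
  by rewrite cpartZ.
by rewrite linearZ_LR cpartZ.
Qed.

Lemma real_coords_inj : injective real_coords.
Proof.
move=> p q /ffunP pq; rewrite [p]surjective_pairing [q]surjective_pairing.
congr pair; apply/matrixP => i j.
  by apply: cpart_inj => b; have := pq (inl (i, j, b)); rewrite !ffunE.
rewrite (coord_vbasis (memvf (p.2 i j))) (coord_vbasis (memvf (q.2 i j))).
apply: eq_bigr => k _; congr (_ *: _).
by apply: cpart_inj => b; have := pq (inr (i, j, k, b)); rewrite !ffunE.
Qed.

(** This sees only the real part of the trace, which on the cone is the whole trace. *)
Definition trace_coord (f : {ffun coord_index -> R^o}) : R^o :=
  \sum_i f (inl (i, i, true)).

Lemma trace_coord_is_linear : linear trace_coord.
Proof.
move=> t f g; rewrite scaler_sumr -big_split; apply: eq_bigr => i _ /=.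
by rewrite !ffunE.
Qed.

HB.instance Definition _ := GRing.isLinear.Build R {ffun coord_index -> R^o} R^o
  _ trace_coord trace_coord_is_linear.

Lemma trace_real_coords p : trace_coord (real_coords p) = complex.Re (\tr p.1).
Proof.
have -> : complex.Re (\tr p.1) = \sum_i cpart true (p.1 i i).
  by apply: (big_morph (cpart true)) => [z w|]; rewrite ?cpartD.
by apply: eq_bigr => i _; rewrite ffunE.
Qed.

End RealCoordinates.

(** * Recovering the set from its matrix extreme points *)

Theorem theorem1p10 (R : realType) (V : vectTvsType R[i])
    (hausdorffV : hausdorff_space V) (X : mx_family V)
    (compactX : forall n, compact (X n)) (convexX : matrix_convex X) :
  forall n, X n = matrix_convex_hull (matrix_extreme X) n.
Proof.
(* The hull is contained in [X] because [X] is itself a matrix convex set containing its matrix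
   extreme points. *)
move=> n; apply/seteqP; split=> x; last by apply=> // k y [].
move=> Xx Y convexY extY.
have trQ p : mx_cone X p -> 0 < \tr p.1.
  by move=> [r [g [y [_ g0 ->]]]]; apply: mxtrace_gram_gt0.
pose img (Z : mx_family V) f := exists2 p, mx_cone Z p & real_coords (n := n) p = f.
have coneImg Z : matrix_convex Z -> is_cone (img Z).
  move=> cZ; split=> [_ _ [p Zp <-] [q Zq <-]|t _ t0 [p Zp <-]].
    by exists (p + q); [exact: mx_coneD|rewrite real_coordsD].
  exists (rscale t p); last by rewrite real_coordsZ.
  by apply: mx_coneZ; rewrite ?ltcR.
have XE : mx_cone X (1%:M, x).
  exists n, 1%:M, x; rewrite matrix_nonzero1 compr1 /gram trmx1 map_mx1 mulmx1.
  by split.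
(* If [(1, x)] is in the cone of [Y], then [x] is a compression of an element of [Y] by an isometry,
   hence in [Y]. *)
suff [[a z] [r [g [y [Yy _ [-> ->]]]]] /real_coords_inj[g1 <-]] :
    img Y (real_coords (1%:M, x)) by apply: matrix_convex_compr.
apply: (cone_extreme_ray_ind (tau := @trace_coord R V n) (Q := img X)).
- exact: coneImg.
- exact: coneImg.
- move=> _ [p /trQ + <-]; rewrite /= trace_real_coords.
  by rewrite ltcE => /andP[].
- move=> _ v [p Xp <-] v0 trv [q Xq qE].
  pose w := q - p.
  have wE : real_coords w = v.
    by apply: (addrI (real_coords p)); rewrite -real_coordsD addrC subrK.
  have w0 : w != 0.
    apply: contra_neq v0; rewrite -wE => ->.
    by apply: (addrI (real_coords 0)); rewrite -real_coordsD !addr0.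
  have trw : \tr w.1 = 0.
    (* The real parts of the traces of [p] and [q] agree; both traces are positive, hence real. *)
    move: trv; rewrite -wE /= trace_real_coords raddfB /=.
    have := trQ _ _ Xp; have := trQ _ _ Xq.
    case: (\tr q.1) (\tr p.1) => [a b] [c d]; rewrite !ltcE /=.
    move=> /andP[/eqP -> _] /andP[/eqP -> _] /subr0_eq ->.
    by rewrite subrr.
  have Xpw : mx_cone X (p + w) by rewrite addrC subrK.
  have [t t0 [Xt maxt]] :=
    mx_cone_exit hausdorffV compactX convexX Xx Xp w0 trw Xpw.
  exists t => //; split.
    by exists (p + rscale t w); rewrite // real_coordsD real_coordsZ wE.
  move=> t' tt' [r Xr rE]; apply: (maxt t' tt').
  suff -> : p + rscale t' w = r by [].
  by apply: real_coords_inj; rewrite real_coordsD real_coordsZ wE.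
- move=> _ [[e Xe <-] ext].
  have [r [g [y [h [Xy gh eE]]]]] := mx_cone_onto convexX Xe.
  exists e => //; exists r, g, y; split=> //.
    apply: extY; apply: (matrix_extreme_of_extreme_ray Xy gh) => // p q Xp Xq pqE.
    (* Extremality in coordinates gives a real factor, carried back by injectivity. *)
    have [|||t tE] := ext (real_coords p) (real_coords q).
    - by exists p.
    - by exists q.
    - by rewrite -real_coordsD -pqE -eE.
    exists t%:C%C; apply: real_coords_inj.
    by rewrite tE -real_coordsZ eE.
  apply/eqP => g0; move: gh; rewrite g0 mul0mx => /eqP.
  by rewrite eq_sym (negPf (matrix_nonzero1 _ _)).
- by exists (1%:M, x).
Qed.
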